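(* Let $M^{n+1}\subset\mathbb{R}^{n+2}$ be a hypersurface and let $N^n\subset M^{n+1}$ be a codimension $1$ immersed submanifold such that the immersion $N\subset M\subset\mathbb{R}^{n+2}$ is non-degenerate. Then there exists a unique direction $\xi$ along $N$, tangent to $M$ and transversal to $N$, such that $D_X\xi$ is tangent to $M$ for every $p\in N$ and every $X\in T_pN$. (A direction is a smooth line field along $N$; the condition is required of any, equivalently every, local nowhere-vanishing section $\xi$ of it.)
   Context: $D$ is the standard flat connection of $\mathbb{R}^{n+2}$; all objects are smooth. Given a vector field $\eta$ along $N$ transversal to $M$ and a vector field $\xi_1$ along $N$ tangent to $M$ and transversal to $N$, for $X,Y$ tangent to $N$ write uniquely $D_XY=\nabla_XY+h^1(X,Y)\xi_1+h^2(X,Y)\eta$ with $\nabla_XY$ tangent to $N$. The immersion $N\subset M\subset\mathbb{R}^{n+2}$ is called non-degenerate if for a local frame $\{X_1,\dots,X_n\}$ of $TN$ the matrix $(h^2(X_i,X_j))$ is non-degenerate at each point (this does not depend on the choices of frame, $\xi_1$ and $\eta$). *)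

(* Defs.v *)
From HB Require Import structures.
From mathcomp Require Import all_boot all_order all_algebra.
From mathcomp Require Import all_classical all_reals all_analysis.

Set Implicit Arguments.
Unset Strict Implicit.
Unset Printing Implicit Defensive.

Import Order.TTheory GRing.Theory Num.Theory.
Import numFieldNormedType.Exports.

Local Open Scope classical_set_scope.
Local Open Scope ring_scope.

(* Meant for an open [A]; the values of [f] outside [A] are then irrelevant. *)
Fixpoint Ck_on (R : realType) (m k : nat) (r : nat) (A : set 'rV[R]_m)
    (f : 'rV[R]_m -> 'rV[R]_k) : Prop :=
  if r is r'.+1 then
    (forall x, A x -> differentiable f x) /\
    (forall v : 'rV[R]_m, Ck_on r' A (fun x => 'D_v f x))
  else forall x, A x -> {for x, continuous f}.

Definition Cinfty_on (R : realType) (m k : nat) (A : set 'rV[R]_m)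
    (f : 'rV[R]_m -> 'rV[R]_k) : Prop :=
  forall r, Ck_on r A f.

(* Charts and their inverses are total functions, meaningful only on the chart
   domain and on its image.  [chart_at p] is a preferred chart around [p]; it
   serves to write tangent vectors at [p] in coordinates. *)
Record manifold (R : realType) (n : nat) := Manifold {
  carrier :> topologicalType;
  manifold_hausdorff : hausdorff_space carrier;
  manifold_second_countable : @second_countable carrier;
  chart_index : Type;
  chart_dom : chart_index -> set carrier;
  chart : chart_index -> carrier -> 'rV[R]_n;
  chart_inv : chart_index -> 'rV[R]_n -> carrier;
  chart_at : carrier -> chart_index;
  chart_dom_at : forall p, chart_dom (chart_at p) p;
  chart_dom_open : forall i, open (chart_dom i);
  chart_img_open : forall i, open (chart i @` chart_dom i);
  chart_invK : forall i p, chart_dom i p -> chart_inv i (chart i p) = p;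
  chart_continuous : forall i p, chart_dom i p -> {for p, continuous (chart i)};
  chart_inv_continuous : forall i x,
    (chart i @` chart_dom i) x -> {for x, continuous (chart_inv i)};
  chart_transition : forall i j,
    Cinfty_on (chart i @` (chart_dom i `&` chart_dom j))
              (chart j \o chart_inv i) }.

Section SmoothMaps.
Context {R : realType}.

Definition smooth_on n (N : manifold R n) k (W : set N)
    (f : N -> 'rV[R]_k) : Prop :=
  forall i : chart_index N,
    Cinfty_on (chart i @` (chart_dom i `&` W)) (f \o chart_inv i).

Definition smooth_map n m (N : manifold R n) (M : manifold R m)
    (g : N -> M) : Prop :=
  continuous g /\
  forall (i : chart_index N) (j : chart_index M),
    Cinfty_on (chart i @` (chart_dom i `&` g @^-1` chart_dom j))
              (chart j \o g \o chart_inv i).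

(* The differential at [p], where T_pN is identified with R^n through the
   preferred chart at [p]. *)
Definition mdiff n (N : manifold R n) k (f : N -> 'rV[R]_k) (p : N) :
    'Hom('rV[R]_n, 'rV[R]_k) :=
  linfun ('d (f \o chart_inv (chart_at p)) (chart (chart_at p) p)).

Definition immersion_vec n (N : manifold R n) k (f : N -> 'rV[R]_k) : Prop :=
  smooth_on setT f /\ forall p, injective (mdiff f p).

Definition immersion_map n m (N : manifold R n) (M : manifold R m)
    (g : N -> M) : Prop :=
  smooth_map g /\
  forall p, injective (mdiff (chart (chart_at (g p)) \o g) p).

(* The tangent space at [p], as a subspace of the ambient R^k. *)
Definition tangent n (N : manifold R n) k (f : N -> 'rV[R]_k) (p : N) :
    {vspace 'rV[R]_k} :=
  limg (mdiff f p).

(* D_v Y for v in [tangent F p] and Y an R^k-valued vector field along the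
   immersion F: v is pulled back to T_pN (the inverse is the true one because
   dF_p is injective), then Y is differentiated in that direction. *)
Definition flatD n (N : manifold R n) k (F Y : N -> 'rV[R]_k) (p : N)
    (v : 'rV[R]_k) : 'rV[R]_k :=
  mdiff Y p (((mdiff F p)^-1)%VF v).

End SmoothMaps.

(* Below, [f] is the immersion of M in R^(n+2) and [iota] that of N in M. *)
Section HypersurfacePair.
Context {R : realType} {n : nat} {M : manifold R n.+1} {N : manifold R n}.
Variables (f : M -> 'rV[R]_n.+2) (iota : N -> M).

Local Notation F := (f \o iota).
Local Notation TN := (tangent F).
Local Notation TM p := (tangent f (iota p)).

Definition transversal_to_M (W : set N) (eta : N -> 'rV[R]_n.+2) : Prop :=
  smooth_on W eta /\ forall p, W p -> eta p \notin TM p.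

Definition tangent_transversal (W : set N) (xi : N -> 'rV[R]_n.+2) : Prop :=
  smooth_on W xi /\ forall p, W p -> xi p \in TM p /\ xi p \notin TN p.

Definition local_frame (W : set N) (X : 'I_n -> N -> 'rV[R]_n.+2) : Prop :=
  (forall i, smooth_on W (X i)) /\
  forall p, W p -> basis_of (TN p) [tuple X i p | i < n].

(* D_X Y = nabla + h1 xi1 + h2 eta at [p], with nabla tangent to N. *)
Definition gauss_decomposition (xi1 eta X Y : N -> 'rV[R]_n.+2) (p : N)
    (nabla : 'rV[R]_n.+2) (h1 h2 : R) : Prop :=
  nabla \in TN p /\
  flatD F Y p (X p) = nabla + h1 *: xi1 p + h2 *: eta p.

(* The data xi1, eta and X always exist near a point, though not globally, and
   the choice made is irrelevant. *)
Definition nondegenerate_immersion : Prop :=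
  forall p0 : N, exists W : set N, [/\ open W, W p0 &
    exists xi1 eta (X : 'I_n -> N -> 'rV[R]_n.+2),
      [/\ tangent_transversal W xi1, transversal_to_M W eta, local_frame W X &
       forall p, W p ->
         exists (nabla : 'I_n -> 'I_n -> 'rV[R]_n.+2) (h1 h2 : 'M[R]_n),
           (forall i j,
              gauss_decomposition xi1 eta (X i) (X j) p
                (nabla i j) (h1 i j) (h2 i j)) /\
           h2 \in unitmx]].

Definition line_section (L : N -> {vspace 'rV[R]_n.+2}) (W : set N)
    (xi : N -> 'rV[R]_n.+2) : Prop :=
  [/\ open W, smooth_on W xi &
      forall p, W p -> xi p != 0 /\ xi p \in L p].

Definition smooth_line_field (L : N -> {vspace 'rV[R]_n.+2}) : Prop :=
  (forall p, \dim (L p) = 1%N) /\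
  forall p, exists W xi, W p /\ line_section L W xi.

Definition direction_tangent_transversal
    (L : N -> {vspace 'rV[R]_n.+2}) : Prop :=
  forall p, (L p <= TM p)%VS /\ (L p :&: TN p = 0)%VS.

Definition derivative_tangent (L : N -> {vspace 'rV[R]_n.+2}) : Prop :=
  forall W xi, line_section L W xi ->
  forall p, W p -> forall X, X \in TN p -> flatD F xi p X \in TM p.

End HypersurfacePair.

(* Main.v *)
Require Import Defs.
From HB Require Import structures.
From mathcomp Require Import all_boot all_order all_algebra.
From mathcomp Require Import all_classical all_reals all_analysis.
Set Implicit Arguments.
Unset Strict Implicit.
Unset Printing Implicit Defensive.

Import Order.TTheory GRing.Theory Num.Theory.
Import numFieldNormedType.Exports.
Local Open Scope classical_set_scope.
Local Open Scope ring_scope.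

(* Locally along N choose a covector field nu whose kernel is TM, namely the
   cross product of a frame X_1, ..., X_n of TN and of xi1.  For Y tangent to M
   along N, nu(Y) = 0 gives nu(D_v Y) = - (D_v nu)(Y).  For Y = X_j this says
   that, up to a nonvanishing factor, h^2 is the matrix of (D_{X_i} nu)(X_j);
   non-degeneracy thus means that nu, D_{X_1} nu, ..., D_{X_n} nu are
   independent and that no nonzero vector of TN is annihilated by all of them.
   For Y = xi it says that the condition on xi is (D_v nu)(xi) = 0.  Hence the
   direction is the common kernel of nu and its derivatives, spanned by their
   cross product, which is polynomial in smooth quantities and thus smooth. *)

(** * Differential calculus of C^r maps on open sets of row vectors *)

Section Calculus.
Context {R : realType}.

(** The first-order expansion at [x] only involves values near [x], so it passes from [f] to [g];
    uniqueness of the differential gives the equality. This transfers differentials between chart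
    expressions that agree only near a point. *)
Lemma near_eq_diff (V W : normedModType R) (f g : V -> W) (x : V) :
  (\near x, f x = g x) -> differentiable f x ->
  differentiable g x /\ 'd g x = 'd f x :> (V -> W).
Proof.
move=> fg df.
have gE : g \o shift x = cst (g x) + 'd f x +o_ 0 id.
  apply/eqaddoP => e e0; have /eqaddoP/(_ _ e0) := diff_locally df.
  have near_g : \forall h \near (0 : V), f (h + x) = g (h + x).
    by move: fg; rewrite (near_shift 0) /= subr0.
  apply: filter_app; near=> h.
  by rewrite /= !fctE /= -(near near_g h) // -(nbhs_singleton fg).
have dE : 'd g x = 'd f x :> (V -> W).
  by apply: diff_unique => //; exact: diff_continuous.
split=> //; apply/diff_locallyP; rewrite dE; split=> //.
exact: diff_continuous.
Unshelve. all: by end_near. Qed.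

Lemma differentiable_row (V : normedModType R) k (f : V -> 'rV[R]_k) x :
  (forall j, differentiable (fun y => f y ord0 j) x) -> differentiable f x.
Proof.
move=> df.
have -> : f = \sum_j (fun y => f y ord0 j *: delta_mx ord0 j).
  apply/funext => y; rewrite fct_sumE; exact: row_sum_delta.
by apply: differentiable_sum => j; exact: differentiableZl.
Qed.

Lemma differentiable_entry (V : normedModType R) k (f : V -> 'rV[R]_k) x j :
  differentiable f x -> differentiable (fun y => f y ord0 j) x.
Proof.
move=> df; apply: (@differentiable_comp _ _ _ _ f (fun v : 'rV[R]_k => v ord0 j)) => //.
exact: differentiable_coord.
Qed.

Lemma derive_entry (V : normedModType R) k (f : V -> 'rV[R]_k) x v j :
  differentiable f x -> 'D_v f x ord0 j = 'D_v (fun y => f y ord0 j) x.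
Proof. by move=> df; rewrite derive_mx ?mxE//; exact: diff_derivable. Qed.

Section Ck.
Context {m : nat}.
Implicit Types (A : set 'rV[R]_m) (f g : 'rV[R]_m -> R).

(** The real-valued counterpart of [Ck_on]: sums, products and determinants are treated entrywise,
    and [Ck_onP] returns to row vectors. *)
Fixpoint Ck_scalar (r : nat) A f : Prop :=
  if r is r'.+1 then
    (forall x, A x -> differentiable f x) /\
    (forall v : 'rV[R]_m, Ck_scalar r' A (fun x => 'D_v f x))
  else forall x, A x -> {for x, continuous f}.

Lemma Ck_scalar_eq r A f g : open A -> (forall x, A x -> f x = g x) ->
  Ck_scalar r A f -> Ck_scalar r A g.
Proof.
move=> oA.
have nearA (P : 'rV[R]_m -> Prop) : (forall x, A x -> P x) ->
    forall x, A x -> \near x, P x.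
  move=> AP x Ax; have : nbhs x A by apply: open_nbhs_nbhs.
  exact: filterS.
elim: r f g => [|r IH] f g fg /=.
  move=> cf x Ax; rewrite /prop_for /continuous_at -fg //.
  exact: (cvg_trans (near_eq_cvg (nearA _ fg _ Ax)) (cf x Ax)).
move=> [df Df]; split=> [x Ax|v].
  by have [] := near_eq_diff (nearA _ fg x Ax) (df x Ax).
apply: IH (Df v) => x Ax; apply: near_eq_derive; exact: (nearA _ fg _ Ax).
Qed.

Lemma Ck_scalar_pred r A f : Ck_scalar r.+1 A f -> Ck_scalar r A f.
Proof.
elim: r f => [|r IH] f /= [df Df].
  by move=> x /df; exact: (@differentiable_continuous _ _ R^o).
by split=> // v; apply: IH; exact: Df.
Qed.

Lemma Ck_scalar_cst r A (c : R) : Ck_scalar r A (fun=> c).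
Proof.
elim: r c => [|r IH] c /=; first by move=> x _; exact: cst_continuous.
split=> [x _|v]; first exact: (differentiable_cst (c : R^o)).
have -> : (fun x => 'D_v (fun=> c) x) = (fun=> 0).
  by apply/funext => x; exact: derive_cst.
exact: IH.
Qed.

Lemma Ck_scalarD r A f g : open A ->
  Ck_scalar r A f -> Ck_scalar r A g -> Ck_scalar r A (fun x => f x + g x).
Proof.
move=> oA; elim: r f g => [|r IH] f g /=.
  by move=> cf cg x Ax; apply: continuousD; [exact: cf|exact: cg].
move=> [df Df] [dg Dg]; split=> [x Ax|v].
  by apply: differentiableD; [exact: df|exact: dg].
apply: Ck_scalar_eq (IH _ _ (Df v) (Dg v)) => // x Ax.
by rewrite -deriveD //; apply: diff_derivable; [exact: df|exact: dg].
Qed.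

Lemma Ck_scalarM r A f g : open A ->
  Ck_scalar r A f -> Ck_scalar r A g -> Ck_scalar r A (fun x => f x * g x).
Proof.
move=> oA; elim: r f g => [|r IH] f g.
  by move=> /= cf cg x Ax; apply: continuousM; [exact: cf|exact: cg].
move=> Cf Cg; move: (Cf) (Cg) => /= [df Df] [dg Dg]; split=> [x Ax|v].
  by apply: differentiableM; [exact: df|exact: dg].
(* Leibniz rule; the undifferentiated factors are lowered from order [r.+1] to [r] so that the
   induction hypothesis applies. *)
apply: (@Ck_scalar_eq _ _ (fun x => f x * 'D_v g x + g x * 'D_v f x)) => //.
  move=> x Ax; rewrite (@deriveM _ _ f g) //.
  - by apply: diff_derivable; exact: df.
  - by apply: diff_derivable; exact: dg.
by apply: Ck_scalarD => //; apply: IH => //; exact: Ck_scalar_pred.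
Qed.

Lemma Ck_scalar_sum r A (I : Type) (s : seq I) (P : pred I) (F : I -> 'rV[R]_m -> R) :
  open A -> (forall i, Ck_scalar r A (F i)) ->
  Ck_scalar r A (fun x => \sum_(i <- s | P i) F i x).
Proof.
move=> oA CF; elim: s => [|i s IH].
  apply: Ck_scalar_eq (Ck_scalar_cst r A 0) => // x _; by rewrite big_nil.
case Pi: (P i); last by apply: Ck_scalar_eq IH => // x _; rewrite big_cons Pi.
apply: Ck_scalar_eq (Ck_scalarD oA (CF i) IH) => // x _.
by rewrite big_cons Pi.
Qed.

Lemma Ck_scalar_prod r A (I : Type) (s : seq I) (F : I -> 'rV[R]_m -> R) :
  open A -> (forall i, Ck_scalar r A (F i)) ->
  Ck_scalar r A (fun x => \prod_(i <- s) F i x).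
Proof.
move=> oA CF; elim: s => [|i s IH].
  apply: Ck_scalar_eq (Ck_scalar_cst r A 1) => // x _; by rewrite big_nil.
apply: Ck_scalar_eq (Ck_scalarM oA (CF i) IH) => // x _.
by rewrite big_cons.
Qed.

Lemma Ck_scalar_det r A k (B : 'rV[R]_m -> 'M[R]_k) :
  open A -> (forall i j, Ck_scalar r A (fun x => B x i j)) ->
  Ck_scalar r A (fun x => \det (B x)).
Proof.
move=> oA CB; apply: Ck_scalar_sum => // s.
apply: Ck_scalarM => //; first exact: Ck_scalar_cst.
by apply: Ck_scalar_prod => // i; exact: CB.
Qed.

Lemma Ck_onP r A k (f : 'rV[R]_m -> 'rV[R]_k) : open A ->
  Ck_on r A f <-> forall j, Ck_scalar r A (fun x => f x ord0 j).
Proof.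
move=> oA; elim: r f => [|r IH] f.
  split=> [cf j x Ax|cf x Ax].
    apply: (@continuous_comp _ _ _ f (fun v : 'rV[R]_k => v ord0 j)).
      exact: cf.
    exact: coord_continuous.
  (* The norm is the maximum of finitely many entries, so finitely many neighbourhoods are
     intersected. *)
  apply/(@cvgrPdist_lt _ _ _ (nbhs x) _ f (f x)) => e e0.
  have : \forall y \near x, forall j, `|f x ord0 j - f y ord0 j| < e.
    by apply: (@filter_forall _ _ _ _ (@nbhs_filter _ x)) => j; move/cvgrPdist_lt: (cf j x Ax); exact.
  apply: (@filterS _ _ (@nbhs_filter _ x)) => y fy; rewrite /Num.Def.normr /= mx_normrE.
  by apply: bigmax_lt => // -[i j] _; rewrite !mxE !ord1; exact: fy.
split=> /= [[df Df] j|Cf].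
  split=> [x Ax|v]; first by apply: differentiable_entry; exact: df.
  have /IH/(_ j) := Df v; apply: Ck_scalar_eq => // x Ax.
  by apply: derive_entry; exact: df.
have df x : A x -> differentiable f x.
  by move=> Ax; apply: differentiable_row => j; have [d _] := Cf j; exact: d.
split=> // v; apply/IH => j; have [_ /(_ v)] := Cf j.
by apply: Ck_scalar_eq => // x Ax; rewrite derive_entry //; exact: df.
Qed.

End Ck.

Lemma Ck_onS m k r (A B : set 'rV[R]_m) (f : 'rV[R]_m -> 'rV[R]_k) :
  B `<=` A -> Ck_on r A f -> Ck_on r B f.
Proof.
move=> BA; elim: r f => [|r IH] f /=; first by move=> cf x /BA; apply: cf.
by move=> [df Df]; split=> [x /BA|v]; [exact: df|exact/IH].
Qed.

(** Chain rule: the derivative of [g \o h] along [v] is the sum over [j] of ['D_v] of the [j]-th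
    entry of [h] times the [j]-th partial derivative of [g] composed with [h]. Induction on [r]
    handles this last factor, with [h] lowered by one order. *)
Lemma Ck_scalar_comp l m r (A : set 'rV[R]_l) (B : set 'rV[R]_m)
    (h : 'rV[R]_l -> 'rV[R]_m) (g : 'rV[R]_m -> R) :
  open A -> (forall x, A x -> B (h x)) ->
  Ck_on r A h -> Ck_scalar r B g -> Ck_scalar r A (g \o h).
Proof.
move=> oA AB; elim: r g => [|r IH] g.
  move=> /= ch cg x Ax; apply: continuous_comp; first exact: ch.
  by apply: cg; exact: AB.
move=> /(Ck_onP _ _ oA) Ch /= [dg Dg].
have Ch' : Ck_on r A h by apply/(Ck_onP _ _ oA) => j; exact: Ck_scalar_pred.
have dh x : A x -> differentiable h x.
  by move=> Ax; apply: differentiable_row => j; have [d _] := Ch j; exact: d.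
split=> [x Ax|v].
  by apply: differentiable_comp; [exact: dh|apply: dg; exact: AB].
apply: (@Ck_scalar_eq _ _ _ (fun x => \sum_j
    'D_v (fun y => h y ord0 j) x * ('D_(delta_mx ord0 j) g \o h) x)) => //.
  move=> x Ax.
  have dgx : differentiable g (h x) by apply: dg; exact: AB.
  have dhx := dh x Ax.
  rewrite [RHS]deriveE; last exact: differentiable_comp.
  rewrite diff_comp //= -(deriveE _ dhx) [X in _ = 'd g _ X]row_sum_delta linear_sum.
  apply: eq_bigr => j _.
  by rewrite linearZ /= -deriveE // derive_entry.
apply: Ck_scalar_sum => // j; apply: Ck_scalarM => //.
  by have [_] := Ch j; apply.
by apply: IH.
Qed.

End Calculus.

(** * Linear algebra: cross products and independent rows *)

Section CrossProduct.
Context {K : fieldType} {n : nat}.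
Implicit Types (A : 'M[K]_(n, n.+1)) (x u v : 'rV[K]_n.+1).

(** The signed maximal minors: the generalized cross product of the rows of [A]. *)
Definition cross A : 'rV[K]_n.+1 := \row_k ((-1) ^+ k * \det (col' k A)).

(** Laplace expansion along the row [u], whose cofactors are the entries of [cross A]. *)
Lemma det_cross u A : \det (col_mx u A : 'M[K]_(1 + n)) = (u *m (cross A)^T) ord0 ord0.
Proof.
rewrite (expand_det_row _ (lshift n ord0)) mxE; apply: eq_bigr => k _.
rewrite col_mxEu !mxE /cofactor /= add0n; congr (_ * (_ * \det _)).
apply/matrixP => i j; rewrite !mxE.
have -> : lift (lshift n (@ord0 0)) i = rshift 1 i by apply/val_inj.
by case: splitP => [[[]] //|k' /= [/val_inj ->]].
Qed.

(** By [det_cross], each entry is a determinant with a repeated row. *)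
Lemma cross_orthogonal A : A *m (cross A)^T = 0.
Proof.
apply/row_matrixP => i; rewrite row_mul row0.
apply/matrixP => a b; rewrite !ord1 -det_cross [RHS]mxE.
apply: (@determinant_alternate _ _ _ (lshift n ord0) (rshift 1 i)) => // k.
by rewrite col_mxEu col_mxEd mxE.
Qed.

(** For the converse, a zero pairing makes [col_mx x A] singular, so its rank is already that of [A]
    and [x] adds nothing to the row space. *)
Lemma sub_cross A x : row_free A -> (x <= A)%MS = (x *m (cross A)^T == 0).
Proof.
move=> fA; apply/idP/eqP => [/submxP[D ->]|xA].
  by rewrite -mulmxA cross_orthogonal mulmx0.
have : ~~ row_free (col_mx x A : 'M[K]_(1 + n)).
  by rewrite row_free_unit unitmxE det_cross xA mxE unitr0.
rewrite -row_leq_rank -ltnNge => le_r.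
have sA : (A <= col_mx x A)%MS by rewrite -addsmxE addsmxSr.
have : (col_mx x A <= A)%MS.
  rewrite -(geq_leqif (mxrank_leqif_sup sA)).
  by move: fA => /eqP ->.
by rewrite col_mx_sub => /andP[].
Qed.

(** If the cross product vanished, [sub_cross] would put all of K^(n+1) in the span of [n] rows. *)
Lemma cross_neq0 A : row_free A -> cross A != 0.
Proof.
move=> fA; apply/eqP => A0.
have /mxrankS : (1%:M <= A)%MS.
  by apply/row_subP => i; rewrite sub_cross // A0 trmx0 mulmx0.
by rewrite mxrank1 leqNgt ltnS rank_leq_row.
Qed.

(** The orthogonal of [n] independent rows is a line, and it contains the nonzero vector
    [cross A]. *)
Lemma orthogonal_cross A x :
  row_free A -> A *m x^T = 0 -> exists c, x = c *: cross A.
Proof.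
move=> fA xA; apply/sub_rVP.
have kerE y : A *m y^T = 0 -> (y <= kermx A^T)%MS.
  by move=> Ay; apply/sub_kermxP/trmx_inj; rewrite trmx_mul trmxK Ay trmx0.
have rk : \rank (kermx A^T) = 1%N.
  by rewrite mxrank_ker mxrank_tr; move: fA => /eqP ->; rewrite subSnn.
apply: submx_trans (kerE _ _ xA) _.
rewrite -(geq_leqif (mxrank_leqif_sup (kerE _ _ (cross_orthogonal A)))) rk.
by rewrite rank_rV cross_neq0.
Qed.

End CrossProduct.

(** Multiplying a relation [a *m nu + b *m J = 0] by [X^T] kills the first term and leaves
    [b *m (J *m X^T) = 0], so [b = 0]; then [a = 0] because [nu] is nonzero. It is applied with [J]
    the Jacobian of a conormal and [X] a frame of TN. *)
Lemma row_free_col_mx (K : fieldType) n (nu : 'rV[K]_n.+2)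
    (J X : 'M[K]_(n, n.+2)) (P : 'M[K]_n) :
  nu != 0 -> nu *m X^T = 0 -> P *m (J *m X^T) \in unitmx ->
  row_free (col_mx nu J).
Proof.
move=> nu0 nuX; rewrite unitmx_mul => /andP[_ JXu].
rewrite -kermx_eq0; apply/rowV0P => u /sub_kermxP.
rewrite -[u]hsubmxK mul_row_col.
set a := lsubmx u; set b := rsubmx u => ab0.
have b0 : b = 0.
  have : b *m (J *m X^T) = 0.
    have := congr1 (mulmx^~ X^T) ab0.
    by rewrite mulmxDl -!mulmxA nuX mulmx0 add0r mul0mx.
  by move/(congr1 (mulmx^~ (invmx (J *m X^T)))); rewrite mulmxK // mul0mx.
move: ab0; rewrite b0 mul0mx addr0 (mx11_scalar a) mul_scalar_mx.
by move/eqP; rewrite scaler_eq0 (negPf nu0) orbF => /eqP ->; rewrite raddf0 row_mx0.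
Qed.

Lemma row_free_col_mx_notin (K : fieldType) m n (x : 'rV[K]_n) (A : 'M[K]_(m, n)) :
  row_free A -> ~~ (x <= A)%MS -> row_free (col_mx x A).
Proof.
move=> fA xA; rewrite -kermx_eq0; apply/rowV0P => u /sub_kermxP.
rewrite -[u]hsubmxK mul_row_col.
set a := lsubmx u; set b := rsubmx u.
rewrite (mx11_scalar a) mul_scalar_mx => ab0.
have a0 : a ord0 ord0 = 0.
  apply/eqP; apply: contraNT xA => a0; apply/submxP.
  exists (- (a ord0 ord0)^-1 *: b); rewrite -scalemxAl.
  apply: (scalerI a0); rewrite scalerA mulrN mulfV // scaleN1r.
  by apply/eqP; rewrite -addr_eq0 ab0.
move: ab0; rewrite a0 scale0r add0r => b0.
have -> : b = 0 by apply: (row_free_inj fA); rewrite b0 mul0mx.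
by rewrite raddf0 row_mx0.
Qed.

Lemma col_mx_mul_eq0 (K : fieldType) m n (u x : 'rV[K]_n) (A : 'M[K]_(m, n)) :
  col_mx u A *m x^T = 0 <-> x *m u^T = 0 /\ A *m x^T = 0.
Proof.
rewrite mul_col_mx; split=> [/eqP|[xu ->]].
  rewrite col_mx_eq0 => /andP[/eqP ux /eqP ->]; split=> //.
  by apply/trmx_inj; rewrite trmx_mul trmxK ux trmx0.
suff -> : u *m x^T = 0 by rewrite col_mx0.
by apply/trmx_inj; rewrite trmx_mul trmxK xu trmx0.
Qed.

Lemma mem_cross_line (K : fieldType) n (A : 'M[K]_(n, n.+1)) x :
  row_free A -> x \in <[cross A]>%VS <-> A *m x^T = 0.
Proof.
move=> fA; split=> [/vlineP[c ->]|/(orthogonal_cross fA) xA]; last exact/vlineP.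
by rewrite linearZ /= -scalemxAr cross_orthogonal scaler0.
Qed.

(* Locked, because failing conversions between differentials do not terminate
   in practice. *)
HB.lock Definition chart_jacobian (R : realType) n (N : manifold R n) k
    (i : chart_index N) (Y : N -> 'rV[R]_k) (q : N) : 'M[R]_(n, k) :=
  'J (Y \o chart_inv i) (chart i q).

(** * Jacobians in charts, smoothness and tangent spaces *)

Section Charts.
Context {R : realType} {n : nat} {N : manifold R n}.

Lemma near_chart_inv (i : chart_index N) (W : set N) q :
  open W -> W q -> chart_dom i q ->
  \forall x \near chart i q, W (chart_inv i x).
Proof.
move=> oW Wq iq.
have ci : {for chart i q, continuous (chart_inv i)}.
  by apply: chart_inv_continuous; exists q.
apply: ci; rewrite chart_invK //; exact: open_nbhs_nbhs.
Qed.

Lemma open_chart_image (i : chart_index N) (W : set N) :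
  open W -> open (chart i @` (chart_dom i `&` W)).
Proof.
move=> oW; rewrite openE => _ [q [iq Wq] <-].
have near_img : nbhs (chart i q) (chart i @` chart_dom i).
  by apply: open_nbhs_nbhs; split; [exact: chart_img_open|exists q].
have near_W := near_chart_inv oW Wq iq.
apply: filterS2 near_img near_W => x [q' iq' <-] /=.
by rewrite chart_invK // => Wq'; exists q'.
Qed.

Section Jacobian.
Context {k : nat}.
Implicit Types (Y nu : N -> 'rV[R]_k) (W : set N).

Lemma mul_chart_jacobian i Y q w :
  w *m chart_jacobian i Y q = 'd (Y \o chart_inv i) (chart i q) w.
Proof. by rewrite chart_jacobian.unlock; exact: mul_rV_lin1. Qed.

Lemma row_chart_jacobian i Y q a :
  differentiable (Y \o chart_inv i) (chart i q) ->
  row a (chart_jacobian i Y q) =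
  'D_(delta_mx ord0 a) (Y \o chart_inv i) (chart i q).
Proof.
by move=> dY; rewrite rowE mul_chart_jacobian; exact: esym (deriveE _ dY).
Qed.

Lemma mdiffE Y q w : mdiff Y q w = w *m chart_jacobian (chart_at q) Y q.
Proof. by rewrite mul_chart_jacobian /mdiff lfunE. Qed.

Lemma tangentE Y q x :
  (x \in tangent Y q) = (x <= chart_jacobian (chart_at q) Y q)%MS.
Proof.
apply/memv_imgP/submxP => [[w _ ->]|[w ->]]; first by exists w; rewrite mdiffE.
by exists w; rewrite ?memvf ?mdiffE.
Qed.

Lemma smooth_on_differentiable W Y i q :
  smooth_on W Y -> W q -> chart_dom i q ->
  differentiable (Y \o chart_inv i) (chart i q).
Proof. by move=> /(_ i 1%N) [dY _] Wq iq; apply: dY; exists q. Qed.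

(** Chain rule, with [P] the Jacobian of the transition map. It is needed because the preferred
    chart varies from point to point. *)
Lemma chart_jacobian_change W Y i j q :
  open W -> smooth_on W Y -> W q -> chart_dom i q -> chart_dom j q ->
  exists P, chart_jacobian i Y q = P *m chart_jacobian j Y q.
Proof.
move=> oW sY Wq iq jq.
pose t := chart j \o chart_inv i.
have tq : t (chart i q) = chart j q by rewrite /t /= chart_invK.
have dt : differentiable t (chart i q).
  by have [d _] := chart_transition i j 1%N; apply: d; exists q.
have dY : differentiable (Y \o chart_inv j) (t (chart i q)).
  by rewrite tq; exact: smooth_on_differentiable sY _ _.
have near_t : \forall x \near chart i q, ((Y \o chart_inv j) \o t) x
    = (Y \o chart_inv i) x.
  have := near_chart_inv (chart_dom_open j) jq iq.
  by apply: filterS => x jx; rewrite /t /= chart_invK.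
have [_ dE] := near_eq_diff near_t (differentiable_comp dt dY).
exists ('J t (chart i q)); apply/row_matrixP => a.
rewrite [LHS]rowE [RHS]rowE mulmxA [LHS]mul_chart_jacobian [RHS]mul_chart_jacobian.
apply: (etrans (congr1 (fun h => h (delta_mx ord0 a)) dE)).
apply: (etrans (congr1 (fun h => h (delta_mx ord0 a)) (diff_comp dt dY))).
by rewrite -tq /jacobian mul_rV_lin1.
Qed.

(** Differentiating nu(Y) = 0 by the Leibniz rule gives (D_v nu)(Y) = - nu(D_v Y); each row is the
    case where v is a coordinate direction of the chart. *)
Lemma orthogonal_jacobian W nu Y i q :
  open W -> smooth_on W nu -> smooth_on W Y ->
  (forall q', W q' -> nu q' *m (Y q')^T = 0) -> W q -> chart_dom i q ->
  chart_jacobian i nu q *m (Y q)^T = - (chart_jacobian i Y q *m (nu q)^T).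
Proof.
move=> oW snu sY nuY Wq iq; set x := chart i q.
pose f a := fun y => (nu \o chart_inv i) y ord0 a.
pose g a := fun y => (Y \o chart_inv i) y ord0 a.
have dnu := smooth_on_differentiable snu Wq iq.
have dY := smooth_on_differentiable sY Wq iq.
have df v a : derivable (f a) x v by exact/diff_derivable/differentiable_entry.
have dg v a : derivable (g a) x v by exact/diff_derivable/differentiable_entry.
apply/row_matrixP => b; rewrite row_mul raddfN /= row_mul.
rewrite (row_chart_jacobian b dnu).
rewrite (row_chart_jacobian b dY).
set v : 'rV[R]_n := delta_mx ord0 b.
have zero : 'D_v (\sum_a f a * g a) x = 0.
  rewrite -(derive_cst (0 : R^o) x v); apply: near_eq_derive.
  have := near_chart_inv oW Wq iq; apply: filterS => y Wy.
  have := congr1 (fun A : 'M[R]_1 => A ord0 ord0) (nuY _ Wy).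
  rewrite fct_sumE [X in X = _ -> _]mxE [X in _ = X -> _]mxE => e0.
  apply: etrans e0; apply: eq_bigr => a _; by rewrite mxE.
rewrite derive_sum in zero; last by move=> a; exact: derivableM.
apply/matrixP => c e; rewrite !ord1 !mxE; apply/eqP; rewrite -addr_eq0 -big_split /=.
rewrite -[X in _ == X]zero; apply/eqP/eq_bigr => a _.
rewrite (@deriveM _ _ (f a) (g a)) // addrC !mxE !derive_entry //.
rewrite /f /g /= chart_invK //; congr (_ + _); exact: mulrC.
Qed.

End Jacobian.

Lemma smooth_on_cross (W : set N) k (B : N -> 'M[R]_(k, k.+1)) :
  open W -> (forall i, smooth_on W (fun q => row i (B q))) ->
  smooth_on W (fun q => cross (B q)).
Proof.
move=> oW sB i r; have oU := open_chart_image (i := i) oW.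
apply/(Ck_onP _ _ oU) => j.
apply: (@Ck_scalar_eq _ _ _ _ (fun x => (-1) ^+ j * \det (col' j (B (chart_inv i x))))) => //.
  by move=> x _; rewrite mxE.
apply: Ck_scalarM => //; first exact: Ck_scalar_cst.
apply: Ck_scalar_det => // a b.
have /(Ck_onP _ _ oU)/(_ (lift j b)) := sB a i r.
by apply: Ck_scalar_eq => // x _; rewrite /= !mxE.
Qed.

Lemma smooth_on_subset (V W : set N) k (Y : N -> 'rV[R]_k) :
  V `<=` W -> smooth_on W Y -> smooth_on V Y.
Proof.
move=> VW sY i r; apply: Ck_onS (sY i r) => _ [q [iq /VW Wq] <-].
by exists q.
Qed.

(** The row is a partial derivative in chart [i], while smoothness is tested in an arbitrary chart
    [j]: order [r] follows from order [r.+1] of [Y] in chart [i], composed with the transition map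
    from [j] to [i]. *)
Lemma smooth_on_chart_jacobian_row (W : set N) k (Y : N -> 'rV[R]_k)
    (i : chart_index N) a :
  open W -> smooth_on W Y ->
  smooth_on (chart_dom i `&` W) (fun q => row a (chart_jacobian i Y q)).
Proof.
move=> oW sY j r.
have oV : open (chart_dom i `&` W) by apply: openI => //; exact: chart_dom_open.
have oU := open_chart_image (i := j) oV.
apply/(Ck_onP _ _ oU) => b.
have oUi := open_chart_image (i := i) oW.
have CY : Ck_on r (chart i @` (chart_dom i `&` W))
    (fun x => 'D_(delta_mx ord0 a) (Y \o chart_inv i) x).
  by have [_] := sY i r.+1; apply.
have /(_ b) := (Ck_onP _ _ oUi).1 CY.
have Ct : Ck_on r (chart j @` (chart_dom j `&` (chart_dom i `&` W)))
    (chart i \o chart_inv j).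
  apply: Ck_onS (chart_transition j i r) => _ [q [jq [iq _]] <-].
  by exists q.
have tU x : (chart j @` (chart_dom j `&` (chart_dom i `&` W))) x ->
    (chart i @` (chart_dom i `&` W)) ((chart i \o chart_inv j) x).
  by move=> [q [jq [iq Wq]] <-]; exists q; rewrite //= chart_invK.
move=> /(Ck_scalar_comp oU tU Ct); apply: Ck_scalar_eq => // _ [q [jq [iq Wq]] <-].
rewrite /= chart_invK // (row_chart_jacobian _ (smooth_on_differentiable sY _ _)) //.
Qed.

End Charts.

(** Chain rule in charts: the image of d(f o iota) lies in the image of df. *)
Lemma tangent_comp (R : realType) n m k (N : manifold R n) (M : manifold R m)
    (f : M -> 'rV[R]_k) (iota : N -> M) p :
  smooth_on setT f -> smooth_map iota ->
  (tangent (f \o iota) p <= tangent f (iota p))%VS.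
Proof.
move=> sf [ciota siota]; set a := chart_at p; set b := chart_at (iota p).
have ap : chart_dom a p := chart_dom_at p.
have bp : chart_dom b (iota p) := chart_dom_at (iota p).
pose t := chart b \o iota \o chart_inv a.
have tp : t (chart a p) = chart b (iota p) by rewrite /t /= chart_invK.
have dt : differentiable t (chart a p).
  by have [d _] := siota a b 1%N; apply: d; exists p.
have df : differentiable (f \o chart_inv b) (t (chart a p)).
  by rewrite tp; exact: smooth_on_differentiable sf _ _.
have near_t : \forall x \near chart a p, ((f \o chart_inv b) \o t) x
    = ((f \o iota) \o chart_inv a) x.
  have oW : open (iota @^-1` chart_dom b).
    by apply: open_comp => [x _|]; [exact: ciota|exact: chart_dom_open].
  have := near_chart_inv oW bp ap.
  by apply: filterS => x bx; rewrite /t /= chart_invK.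
have [_ dE] := near_eq_diff near_t (differentiable_comp dt df).
apply/subvP => _ /memv_imgP[w _ ->]; rewrite mdiffE -/a mul_chart_jacobian.
rewrite tangentE -/b; apply/submxP; exists ('d t (chart a p) w).
rewrite mul_chart_jacobian -tp.
apply: (etrans (congr1 (fun h => h w) dE)).
exact: (congr1 (fun h => h w) (diff_comp dt df)).
Qed.

Lemma basis_of_rows (K : fieldType) m k (U : {vspace 'rV[K]_k})
    (X : 'I_m -> 'rV[K]_k) :
  basis_of U [tuple X i | i < m] ->
  row_free (\matrix_i X i) /\
  forall x, (x \in U) = (x <= \matrix_i X i)%MS.
Proof.
move=> /andP[/eqP spanX freeX].
have sumX (c : 'rV[K]_m) : c *m (\matrix_i X i) = \sum_i c ord0 i *: X i.
  by rewrite mulmx_sum_row; apply: eq_bigr => i _; rewrite rowK.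
split.
  rewrite -kermx_eq0; apply/rowV0P => c /sub_kermxP; rewrite sumX => cX.
  apply/rowP => i; rewrite mxE; move/freeP: freeX => /(_ (c ord0)); apply.
  by rewrite -[RHS]cX; apply: eq_bigr => j _; rewrite nth_mktuple.
move=> x; rewrite -spanX; apply/idP/submxP => [/coord_span xE|[c ->]].
  exists (\row_i coord [tuple X i | i < m] i x); rewrite sumX {1}xE.
  by apply: eq_bigr => i _; rewrite mxE nth_mktuple.
rewrite sumX; apply: memv_suml => i _; apply: memvZ; apply: memv_span.
by apply/tnthP; exists i; rewrite tnth_mktuple.
Qed.

(** * Local conormal fields of M along N *)

Section Conormal.
Context {R : realType} {n : nat} {M : manifold R n.+1} {N : manifold R n}.
Variables (f : M -> 'rV[R]_n.+2) (iota : N -> M).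

Local Notation F := (f \o iota).
Local Notation TN := (tangent F).
Local Notation TM p := (tangent f (iota p)).
Local Notation jac p Y := (chart_jacobian (chart_at p) Y p).

(* Up to a nonzero factor and a change of frame, the unit in the last clause is
   the matrix of h^2. *)
Definition conormal (W : set N) (nu : N -> 'rV[R]_n.+2) : Prop :=
  [/\ open W, smooth_on W nu,
      forall p, W p -> nu p != 0 /\
        forall x, (x \in TM p) = (x *m (nu p)^T == 0) &
      forall p, W p -> exists (X : 'M[R]_(n, n.+2)) (P : 'M[R]_n),
        [/\ row_free X, forall x, (x \in TN p) = (x <= X)%MS &
            P *m (jac p nu *m X^T) \in unitmx]].

Lemma exists_conormal : smooth_on setT f -> smooth_map iota ->
  nondegenerate_immersion f iota ->
  forall p, exists W nu, W p /\ conormal W nu.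
Proof.
move=> sf siota hnd p0.
have [W [oW Wp0 [xi1 [eta [X [txi teta lfX H]]]]]] := hnd p0.
case: txi => sxi txi; case: teta => seta teta; case: lfX => sX bX.
pose B q : 'M[R]_(n.+1, n.+2) := col_mx (xi1 q) (\matrix_i X i q).
have TNTM p : (TN p <= TM p)%VS by exact: tangent_comp.
have BP p : W p -> row_free (B p) /\ forall x, (x \in TM p) = (x <= B p)%MS.
  move=> Wp; have [fX TNE] := basis_of_rows (bX p Wp).
  have [xiM xiN] := txi p Wp.
  have fB : row_free (B p).
    by apply: row_free_col_mx_notin => //; rewrite -TNE.
  split=> // x.
  pose G := chart_jacobian (chart_at (iota p)) f (iota p).
  have BG : (B p <= G)%MS.
    apply: (etrans (col_mx_sub (xi1 p) (\matrix_i X i p) G)).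
    rewrite -tangentE xiM /=; apply/row_subP => i.
    by rewrite -tangentE (subvP (TNTM p)) // TNE row_sub.
  (* Dimension count: [B p] has [n.+1] independent rows, and [G] has only [n.+1] rows. *)
  have GB : (G <= B p)%MS.
    rewrite -(geq_leqif (mxrank_leqif_sup BG)).
    by rewrite (eqP fB) rank_leq_row.
  rewrite tangentE; apply/idP/idP => xS; first exact: submx_trans xS GB.
  exact: submx_trans xS BG.
pose nu q := cross (B q).
have sB i : smooth_on W (fun q => row i (B q)).
  case: (splitP (i : 'I_(1 + n))) => j ij.
    rewrite (_ : (fun q => _) = xi1) //; apply/funext => q.
    have -> : i = lshift n j :> 'I_(1 + n) by apply/val_inj.
    apply: (etrans (rowKu j (xi1 q) (\matrix_i X i q))).
    by apply/rowP => k; rewrite mxE ord1.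
  rewrite (_ : (fun q => _) = X j) //; apply/funext => q.
  have -> : i = rshift 1 j :> 'I_(1 + n) by apply/val_inj.
  apply: (etrans (rowKd j (xi1 q) (\matrix_i X i q))).
  exact: rowK.
have snu : smooth_on W nu by exact: smooth_on_cross.
have TME p : W p -> forall x, (x \in TM p) = (x *m (nu p)^T == 0).
  by move=> Wp x; have [fB ->] := BP p Wp; exact: sub_cross.
exists W, nu; split=> //; split=> // p Wp.
  split; last exact: TME.
  by have [fB _] := BP p Wp; exact: cross_neq0.
have [fX TNE] := basis_of_rows (bX p Wp).
have [nabla [h1 [h2 [gauss h2u]]]] := H p Wp.
(* The rows of the second matrix are the chart coordinates of the frame vectors, so that its product
   with [jac p nu] has rows D_{X_i} nu. *)
exists (\matrix_i X i p), (\matrix_i ((mdiff F p)^-1)%VF (X i p)).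
split=> //.
(* The factor relating the two matrices is - nu(eta), nonzero because [eta] is transversal to M. *)
pose e := (eta p *m (nu p)^T) ord0 ord0.
have e0 : e != 0.
  have := teta p Wp; rewrite TME //; apply: contraNneq => e0.
  by rewrite [_ *m _]mx11_scalar -/e e0 raddf0.
rewrite (_ : _ *m _ = - e *: h2) ?unitmxZ ?unitfE ?oppr_eq0 //.
have orth q x : W q -> x \in TN q -> x *m (nu q)^T = 0.
  by move=> Wq xT; apply/eqP; rewrite -TME //; exact: (subvP (TNTM q)).
have XT q j : W q -> X j q \in TN q.
  move=> Wq; have [_ ->] := basis_of_rows (bX q Wq).
  by rewrite -(rowK (fun i => X i q) j) row_sub.
apply/matrixP => i j.
have [nT] := gauss i j; rewrite /flatD mdiffE => dE.
have nuX q : W q -> nu q *m (X j q)^T = 0.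
  move=> Wq; apply/trmx_inj; rewrite trmx_mul trmxK trmx0.
  exact: (orth _ _ Wq (XT _ _ Wq)).
(* (D_{X_i} nu)(X_j) = - nu(D_{X_i} X_j); in the Gauss decomposition [nu] kills the components along
   TN and [xi1], leaving the [eta] term. *)
have /(congr1 (mulmx (((mdiff F p)^-1)%VF (X i p)))) :=
  orthogonal_jacobian oW snu (sX j) nuX Wp (chart_dom_at p).
rewrite mulmxN [in RHS]mulmxA dE !mulmxDl -!scalemxAl (orth _ _ Wp nT) add0r.
have -> : xi1 p *m (nu p)^T = 0.
  by apply/eqP; rewrite -TME //; have [] := txi p Wp.
rewrite scaler0 add0r => /matrixP/(_ ord0 ord0) E.
transitivity ((((mdiff F p)^-1)%VF (X i p) *m (jac p nu *m (X j p)^T)) ord0 ord0).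
  rewrite mulmxA [in RHS]mulmxA [LHS]mxE [RHS]mxE.
  apply: eq_bigr => k _; rewrite !mxE; congr (_ * _).
  by apply: eq_bigr => l _; rewrite !mxE.
by rewrite E [LHS]mxE [X in - X]mxE [RHS]mxE -/e mulrC mulNr.
Qed.

End Conormal.

(** * The tangency condition expressed through a conormal *)

Section Direction.
Context {R : realType} {n : nat} {M : manifold R n.+1} {N : manifold R n}.
Variables (f : M -> 'rV[R]_n.+2) (iota : N -> M).

Local Notation F := (f \o iota).
Local Notation TN := (tangent F).
Local Notation TM p := (tangent f (iota p)).
Local Notation jac p Y := (chart_jacobian (chart_at p) Y p).

Hypothesis TNTM : forall p, (TN p <= TM p)%VS.

Variables (W : set N) (nu : N -> 'rV[R]_n.+2).
Hypothesis cnu : conormal f iota W nu.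

(** The [n] independent rows spanning TN lie in the row space of the Jacobian of [F], so dF is
    injective at [p] and the inverse inside [flatD] really cancels it. *)
Lemma flatD_mdiff Y p w : W p -> flatD F Y p (mdiff F p w) = w *m jac p Y.
Proof.
case: cnu => _ _ _ cX Wp; have [X [P [fX TNE _]]] := cX p Wp.
have fF : row_free (jac p F).
  have XF : (X <= jac p F)%MS.
    by apply/row_subP => i; rewrite -tangentE TNE row_sub.
  rewrite -row_leq_rank; apply: leq_trans (mxrankS XF).
  by rewrite row_leq_rank.
rewrite /flatD lker0_lfunK ?mdiffE //.
by apply/lker0P => w1 w2; rewrite !mdiffE => /(row_free_inj fF).
Qed.

Lemma conormal_row_free i p : W p -> chart_dom i p ->
  row_free (col_mx (nu p) (chart_jacobian i nu p)).
Proof.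
case: cnu => oW snu cTM cX Wp ip.
have [X [P [fX TNE PJX]]] := cX p Wp; have [nu0 TME] := cTM p Wp.
have [Q JE] := chart_jacobian_change oW snu Wp (chart_dom_at p) ip.
(* [Q] turns the Jacobian in chart [i] into the one in the preferred chart, where the unit is
   given. *)
apply: (@row_free_col_mx _ _ _ _ X (P *m Q)) => //; last first.
  by rewrite -mulmxA [Q *m _]mulmxA -JE.
apply/trmx_inj; rewrite trmx_mul trmxK trmx0; apply/row_matrixP => a.
rewrite row_mul row0; apply/eqP; rewrite -TME; apply: (subvP (TNTM p)).
by rewrite TNE row_sub.
Qed.

(** Tangency of D_v Y means nu(D_v Y) = 0, that is, (D_v nu)(Y) = 0. The right side depends on [Y]
    only through [Y p], so the condition is linear algebra at each point; the left side does not
    mention [nu], so two conormals can be compared through it. *)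
Lemma flatD_tangentP (V : set N) Y p :
  open V -> smooth_on V Y -> (forall q, V q -> Y q \in TM q) -> V p -> W p ->
  (forall v, v \in TN p -> flatD F Y p v \in TM p) <->
  jac p nu *m (Y p)^T = 0.
Proof.
case: (cnu) => oW snu cTM cX oV sY YTM Vp Wp.
have nuY q : (V `&` W) q -> nu q *m (Y q)^T = 0.
  move=> [Vq Wq]; apply/trmx_inj; rewrite trmx_mul trmxK trmx0.
  by apply/eqP; have [_ <-] := cTM q Wq; exact: YTM.
have [_ TME] := cTM p Wp.
have -> : jac p nu *m (Y p)^T = - (jac p Y *m (nu p)^T).
  apply: (@orthogonal_jacobian _ _ _ _ (V `&` W)) => //.
  - exact: openI.
  - by apply: smooth_on_subset snu => q [].
  - by apply: smooth_on_subset sY => q [].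
  - exact: chart_dom_at.
split=> [YT|/eqP]; last first.
  rewrite oppr_eq0 => /eqP YT v /memv_imgP[w _ ->].
  by rewrite flatD_mdiff // TME -mulmxA YT mulmx0.
apply/eqP; rewrite oppr_eq0; apply/eqP/row_matrixP => a.
rewrite row_mul row0 rowE; apply/eqP; rewrite -TME -flatD_mdiff //.
by apply: YT; apply: memv_img; rewrite memvf.
Qed.

End Direction.

(** * Existence and uniqueness of the direction *)

Theorem proposition2p2 (R : realType) (n : nat)
    (M : manifold R n.+1) (f : M -> 'rV[R]_n.+2)
    (N : manifold R n) (iota : N -> M)
    (hf : immersion_vec f) (hiota : immersion_map iota)
    (hnd : nondegenerate_immersion f iota) :
  exists! L : N -> {vspace 'rV[R]_n.+2},
    [/\ smooth_line_field L,
        direction_tangent_transversal f iota L &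
        derivative_tangent f iota L].
Proof.
have [sf _] := hf; have [siota _] := hiota.
have TNTM p : (tangent (f \o iota) p <= tangent f (iota p))%VS.
  exact: tangent_comp.
(* One conormal is chosen per point, without gluing: [L p] uses only the conormal and the chart
   attached to [p]. *)
have /choice[c cP] : forall p, exists Wnu : set N * (N -> 'rV[R]_n.+2),
    Wnu.1 p /\ conormal f iota Wnu.1 Wnu.2.
  by move=> p; have [W [nu cnu]] := exists_conormal sf siota hnd p; exists (W, nu).
pose nu p := (c p).2.
pose normals i p q : 'M[R]_(n.+1, n.+2) :=
  col_mx (nu p q) (chart_jacobian i (nu p) q).
pose L p : {vspace 'rV[R]_n.+2} := <[cross (normals (chart_at p) p p)]>%VS.
have free_normals p : row_free (normals (chart_at p) p p).
  have [Wp cnu] := cP p.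
exact (conormal_row_free TNTM cnu Wp (chart_dom_at p)).
have TME p x : x \in tangent f (iota p) <-> x *m (nu p p)^T = 0.
  have [Wp [_ _ cTM _]] := cP p; have [_ ->] := cTM p Wp.
  by split=> /eqP.
have LE p x : x \in L p <-> x \in tangent f (iota p) /\
    chart_jacobian (chart_at p) (nu p) p *m x^T = 0.
  rewrite (mem_cross_line _ (free_normals p)) TME; exact: col_mx_mul_eq0.
have LTM p x : x \in L p -> x \in tangent f (iota p) by move/LE => [].
have dimL p : \dim (L p) = 1%N.
  by rewrite dim_vline cross_neq0.
exists L; split; last first.
  (* Uniqueness: a local section of [L'] spans [L' p], the criterion puts its value in [L p], and
     both are lines. *)
  move=> L' [[dimL' sL'] dL' tL']; apply/funext => p.
  have [V [xi [Vp [oV sxi Vxi]]]] := sL' p.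
  have [xi0 xiL'] := Vxi p Vp.
  have xiTM q : V q -> xi q \in tangent f (iota q).
    by move=> /Vxi[_]; have [sub _] := dL' q; exact/subvP.
  have L'E : (<[xi p]> = L' p)%VS.
    by apply/eqP; rewrite eqEdim -memvE xiL' dim_vline xi0 dimL'.
  apply/eqP; rewrite eq_sym -L'E eqEdim dimL dim_vline xi0 andbT -memvE.
  have [Wp cnu] := cP p; apply/LE; split; first exact: xiTM.
  apply/(flatD_tangentP cnu oV sxi xiTM Vp Wp).
  by apply: tL' Vp; split.
split.
- split=> // p0; set i0 := chart_at p0.
  have [Wp0 cnu0] := cP p0; have [oW snu cTM _] := cnu0.
  pose V := chart_dom i0 `&` (c p0).1.
  (* The conormal and the chart are now frozen at [p0], which makes the cross product smooth in [q];
     it remains to see that it lies in [L q]. *)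
  pose xi q := cross (normals i0 p0 q).
  have oV : open V by apply: openI => //; exact: chart_dom_open.
  have sxi : smooth_on V xi.
    apply: smooth_on_cross => // i.
    case: (splitP (i : 'I_(1 + n))) => j ij.
      rewrite (_ : (fun q => _) = nu p0).
        by apply: smooth_on_subset snu => q [].
      apply/funext => q.
      have -> : i = lshift n j :> 'I_(1 + n) by apply/val_inj.
      apply: (etrans (rowKu j (nu p0 q) (chart_jacobian i0 (nu p0) q))).
      by apply/rowP => k; rewrite mxE ord1.
    rewrite (_ : (fun q => _) = fun q => row j (chart_jacobian i0 (nu p0) q)).
      exact: smooth_on_chart_jacobian_row.
    apply/funext => q.
    have -> : i = rshift 1 j :> 'I_(1 + n) by apply/val_inj.
    exact: (rowKd j (nu p0 q) (chart_jacobian i0 (nu p0) q)).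
  have free0 q : V q -> row_free (normals i0 p0 q).
    by move=> [iq Wq]; exact (conormal_row_free TNTM cnu0 Wq iq).
  have xi_orth q : xi q *m (nu p0 q)^T = 0 /\
      chart_jacobian i0 (nu p0) q *m (xi q)^T = 0.
    by apply/col_mx_mul_eq0; exact: cross_orthogonal.
  have xiTM q : V q -> xi q \in tangent f (iota q).
    move=> [_ Wq]; have [_ ->] := cTM q Wq; apply/eqP.
    by have [] := xi_orth q.
  exists V, xi; split; first by split=> //; exact: chart_dom_at.
  split=> // q Vq; split; first by rewrite cross_neq0 // free0.
  have [iq W0q] := Vq; have [Wq cnu] := cP q.
  apply/LE; split; first exact: xiTM.
  (* Applying the criterion twice replaces the conormal of [q] by that of [p0]; a change of chart
     then leads to [i0]. *)
  apply/(flatD_tangentP cnu oV sxi xiTM Vq Wq).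
  apply/(flatD_tangentP cnu0 oV sxi xiTM Vq W0q).
  have [P ->] := chart_jacobian_change oW snu W0q (chart_dom_at q) iq.
  by rewrite -mulmxA; have [_ ->] := xi_orth q; rewrite mulmx0.
- move=> p; split; first by apply/subvP => x; exact: LTM.
  apply/eqP; rewrite -subv0; apply/subvP => x; rewrite memv_cap memv0.
  (* Transversality: a vector x = d X of TN annihilated by all D_v nu satisfies
     [d *m (J *m X^T)^T = 0], with [J] the Jacobian of the conormal; non-degeneracy forces d = 0. *)
  move=> /andP[/LE[_ Jx] xTN].
  have [Wp [_ _ _ cX]] := cP p; have [X [P [fX TNE PJX]]] := cX p Wp.
  move: xTN; rewrite TNE => /submxP[d xE]; move: PJX.
  rewrite unitmx_mul => /andP[_ JXu].
  have : d *m (chart_jacobian (chart_at p) (nu p) p *m X^T)^T = 0.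
    rewrite trmx_mul trmxK mulmxA -xE; apply/trmx_inj.
    by rewrite trmx_mul trmxK Jx trmx0.
  move/(congr1 (mulmx^~ (invmx (chart_jacobian (chart_at p) (nu p) p *m X^T)^T))).
  by rewrite mulmxK ?unitmx_tr // mul0mx xE => ->; rewrite mul0mx.
- move=> V xi [oV sxi Vxi] p Vp; have [Wp cnu] := cP p.
  have xiTM q : V q -> xi q \in tangent f (iota q).
    by move=> /Vxi[_]; exact: LTM.
  apply/(flatD_tangentP cnu oV sxi xiTM Vp Wp).
  by have [_ /LE[]] := Vxi p Vp.
Qed.
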